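(* For every $g\in B(X)\setminus\{1\}$ there exist unique $g_1,\dots,g_m\in R(X)$ such that $g=\pi(g_1g_2\cdots g_mg_{m-1}\cdots g_1)$ and $g_i\neq g_{i+1}$ for $i=1,\dots,m-1$.
   Context: Words: let $X=\{x_1,\dots,x_r\}$ be a finite ordered set of letters, and let $P=P(X)$ be the set of all non-associative (fully bracketed) words on $X$, including the empty word $1$, with product given by juxtaposition and $1u=u1=u$. $|v|$ is the number of letters of $v$. Products without brackets are left-normed: $v_1v_2\cdots v_n=(\cdots((v_1v_2)v_3)\cdots)v_n$. $Sub(v)$ is the set of nonempty subwords: $Sub(1)=\emptyset$, $Sub(x)=\{x\}$ for $x\in X$, $Sub(v_1v_2)=\{v_1v_2\}\cup Sub(v_1)\cup Sub(v_2)$ for nonempty $v_1,v_2$. Put $C(X)=\{uu,(uv)v\mid u,v\in P\setminus\{1\}\}$ and $W=W(X)=\{v\in P\mid Sub(v)\cap C(X)=\emptyset\}$ (so $1\in W$). The map $\pi:P\to W$ is defined by induction on length: $\pi(1)=1$; $\pi(x)=x$ for $x\in X$; if $u,v\in W$, then $\pi(uv)=1$ if $u=v$, $\pi(uv)=a$ if $u=av$, and $\pi(uv)=uv$ if $uv\in W$; if $u\notin W$ or $v\notin W$, then $\pi(uv)=\pi(\pi(u)\pi(v))$. The sets $R(X)$ and $B(X)$: each nonempty $y\in P$ has a unique decomposition $y=y_1y_2\cdots y_{m-1}y'_m$ (left-normed, nonempty factors) whose first factor is a letter; put $y^t=y'_my_{m-1}\cdots y_1$ and $y^{tt}=(y^t)^t$.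 Words are ordered by: $x_i>x_j$ if $i>j$; $u>v$ if $|u|>|v|$; if $|u|=|v|\ge 2$, $u=u_1u_2$, $v=v_1v_2$ (nonempty factors), then $u>v$ if $u_2>v_2$, or if $u_2=v_2$ and $u_1>v_1$. For $y\in W\setminus\{1\}$ let $y_0=\min\{y^t,y^{tt}\}$, and let $D=\{y_0\mid y,y_0,y_0^t\in W,\ y_0^t\neq y_0\}$. Put $R_1=X$, $R_n=R_{n-1}\cup\{y\in D\mid |y|\le n,\ y=u_1u_2\cdots u_m \text{ for some } u_1,\dots,u_m\in R_{n-1}\}$ for $n>1$, and $R(X)=\bigcup_n R_n$. Put $B(X)=\{1\}\cup\{y\in W\mid y=y_1y_2\cdots y_n,\ y_i\in R(X)\}$. *)

(* Defs.v *)
From HB Require Import structures.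
From mathcomp Require Import all_boot.

Set Implicit Arguments.
Unset Strict Implicit.
Unset Printing Implicit Defensive.

(* Nonempty non-associative words; the letter x_{i+1} is i : 'I_r. *)
Inductive tree (r : nat) : Type :=
  | Letter of 'I_r
  | Node of tree r & tree r.

Fixpoint tree_encode r (t : tree r) : GenTree.tree 'I_r :=
  match t with
  | Letter i => GenTree.Leaf i
  | Node u v => GenTree.Node 0 [:: tree_encode u; tree_encode v]
  end.

Fixpoint tree_decode r (t : GenTree.tree 'I_r) : option (tree r) :=
  match t with
  | GenTree.Leaf i => Some (Letter i)
  | GenTree.Node _ [:: u; v] =>
      if tree_decode u is Some u' then
        if tree_decode v is Some v' then Some (Node u' v') else None
      else None
  | _ => None
  end.

Lemma tree_encodeK r : pcancel (@tree_encode r) (@tree_decode r).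
Proof. by elim=> //= u -> v ->. Qed.

HB.instance Definition _ r := Countable.copy (tree r) (pcan_type (@tree_encodeK r)).

(* The set P(X): [None] is the empty word 1. *)
Definition word (r : nat) : Type := option (tree r).

Definition wone r : word r := None.
Definition wletter r (i : 'I_r) : word r := Some (Letter i).

Definition wmul r (u v : word r) : word r :=
  match u, v with
  | None, _ => v
  | _, None => u
  | Some a, Some b => Some (Node a b)
  end.

Fixpoint tsize r (t : tree r) : nat :=
  match t with
  | Letter _ => 1
  | Node u v => tsize u + tsize v
  end.

Definition wsize r (v : word r) : nat := if v is Some t then tsize t else 0.

(* Left-normed product of a list of words. *)
Definition lnprod r (s : seq (word r)) : word r := foldl (@wmul r) (wone r) s.

Fixpoint tsub r (t : tree r) : seq (word r) :=
  match t with
  | Letter _ => [:: Some t]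
  | Node u v => Some t :: tsub u ++ tsub v
  end.

Definition Sub r (v : word r) : seq (word r) := if v is Some t then tsub t else [::].

Definition inC r (w : word r) : bool :=
  if w is Some (Node a b) then
    (a == b) || (if a is Node _ c then c == b else false)
  else false.

Lemma inCP r (w : word r) :
  reflect (exists u v : word r, [/\ u <> wone r, v <> wone r &
             w = wmul u u \/ w = wmul (wmul u v) v])
          (inC w).
Proof.
apply: (iffP idP).
  case: w => [[//|a b]|//] /= /orP[/eqP->|].
    by exists (Some b), (Some b); split=> //; left.
  case: a => [//|a c] /eqP->.
  by exists (Some a), (Some b); split=> //; right.
by case=> [[u|] [[v|] [//= _ _ []]]] -> /=; rewrite eqxx ?orbT.
Qed.

Definition inW r (v : word r) : bool := ~~ has (@inC r) (Sub v).

(* Reduction of a product uv, for u and v in W. *)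
Definition wred r (u v : word r) : word r :=
  match u, v with
  | None, _ => v
  | _, None => u
  | Some a, Some b =>
      if a == b then None
      else match a with
           | Node c d => if d == b then Some c else Some (Node a b)
           | Letter _ => Some (Node a b)
           end
  end.

Fixpoint tpi r (t : tree r) : word r :=
  match t with
  | Letter _ => Some t
  | Node u v => wred (tpi u) (tpi v)
  end.

(* The map pi : P -> W. It is the only map satisfying the clauses of the
   inductive definition of pi: see [wpi_spec] and [wpi_unique]. *)
Definition wpi r (v : word r) : word r := if v is Some t then tpi t else wone r.

Definition wpi_clauses r (f : word r -> word r) : Prop :=
  [/\ f (wone r) = wone r,
      forall i : 'I_r, f (wletter i) = wletter i,
      forall u v : word r, u <> wone r -> v <> wone r -> inW u -> inW v ->
        [/\ u = v -> f (wmul u v) = wone r,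
            forall a : word r, u = wmul a v -> f (wmul u v) = a &
            inW (wmul u v) -> f (wmul u v) = wmul u v] &
      forall u v : word r, u <> wone r -> v <> wone r -> ~~ (inW u && inW v) ->
        f (wmul u v) = f (wmul (f u) (f v))].

Lemma inW_Node r (a b : tree r) :
  inW (Some (Node a b)) = [&& ~~ inC (Some (Node a b)), inW (Some a) & inW (Some b)].
Proof. by rewrite /inW /= -/(inC (Some (Node a b))) has_cat !negb_or. Qed.

Lemma inW_wred r (u v : word r) : inW u -> inW v -> inW (wred u v).
Proof.
case: u v => [a|] [b|] //= Wa Wb; case: eqP => // /eqP nab.
case: a Wa nab => [i|c d] Wa nab.
  by rewrite inW_Node Wa Wb /= (negPf nab).
case: eqP => [_|/eqP ndb]; first by move: Wa; rewrite inW_Node => /and3P[].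
by rewrite inW_Node Wa Wb /= (negPf nab) (negPf ndb).
Qed.

Lemma inW_wpi r (v : word r) : inW (wpi v).
Proof. by case: v => [t|] //=; elim: t => //= u IHu v IHv; apply: inW_wred. Qed.

Lemma wpi_id r (v : word r) : inW v -> wpi v = v.
Proof.
case: v => [t|] //=; elim: t => //= u IHu v IHv.
rewrite inW_Node => /and3P[/= nC /IHu-> /IHv->] /=.
move: nC; rewrite negb_or => /andP[/negPf-> ].
by case: u {IHu} => // c d /negPf->.
Qed.

Lemma wpi_mul r (u v : word r) : wpi (wmul u v) = wred (wpi u) (wpi v).
Proof. by case: u v => [u|] [v|] //=; case: (tpi u). Qed.

Lemma wpi_spec r : wpi_clauses (@wpi r).
Proof.
split=> // [u v u1 v1 Wu Wv|u v _ _ _].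
  rewrite wpi_mul !wpi_id //; split=> [->|a uE|Wuv].
  - by case: v {v1 Wv} => //= t; rewrite eqxx.
  - rewrite uE in Wu *; case: v a v1 {u1 Wv uE} Wu => [b|] [a|] //= _; last first.
      by rewrite eqxx.
    rewrite inW_Node => /and3P[_ _ _].
    case: eqP => [/(congr1 (@tsize r)) /= E|_]; last by rewrite eqxx.
    have a_gt0 : 0 < tsize a.
      by elim: a {E} => //= c IHc d _; rewrite addn_gt0 IHc.
    by move: a_gt0; rewrite -(ltn_add2r (tsize b)) E ltnn.
  - by rewrite -[in RHS](wpi_id Wuv) wpi_mul !wpi_id.
by rewrite !wpi_mul !(wpi_id (inW_wpi _)).
Qed.

Lemma wpi_unique r (f : word r -> word r) : wpi_clauses f -> f =1 @wpi r.
Proof.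
case=> f1 fl fW fN.
have fred u v : inW u -> inW v -> f u = u -> f v = v -> f (wmul u v) = wred u v.
  case: u v => [a|] [b|] Wa Wb fa fb //=.
  have [||E1 E2 E3] := fW (Some a) (Some b) _ _ Wa Wb => //.
  case: eqP => [ab|/eqP nab]; first by apply: E1; rewrite ab.
  case: a Wa {fa} nab E1 E2 E3 => [i|c d] Wa nab E1 E2 E3.
    by apply: E3; rewrite inW_Node Wa Wb /= (negPf nab).
  case: eqP => [db|/eqP ndb]; first by apply: E2; rewrite /= db.
  by apply: E3; rewrite inW_Node Wa Wb /= (negPf nab) (negPf ndb).
have fid v : inW v -> f v = v.
  case: v => [t|] //; elim: t => [i|u IHu v IHv] //= Wuv; first exact: fl.
  move: (Wuv); rewrite inW_Node => /and3P[_ Wu Wv].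
  by have [||_ _ ->] := fW (Some u) (Some v) _ _ Wu Wv.
case=> [t|] //=; elim: t => [i|u IHu v IHv] /=; first exact: fl.
have Wpu := inW_wpi (Some u); have Wpv := inW_wpi (Some v).
have fP : f (wmul (tpi u) (tpi v)) = wred (tpi u) (tpi v).
  by apply: fred => //; apply: fid.
have [/andP[Wu Wv]|nW] := boolP (inW (Some u) && inW (Some v)).
  by rewrite -fP -/(wpi (Some u)) -/(wpi (Some v)) !wpi_id.
by rewrite (fN (Some u) (Some v)) // IHu IHv.
Qed.

(* The factors of the unique decomposition y = y_1 y_2 ... y'_m (left-normed)
   with y_1 a letter: see [factorsK] and [factors_unique]. *)
Fixpoint tfactors r (t : tree r) : seq (word r) :=
  match t with
  | Letter _ => [:: Some t]
  | Node u v => rcons (tfactors u) (Some v)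
  end.

Definition factors r (y : word r) : seq (word r) := if y is Some t then tfactors t else [::].

Lemma lnprod_rcons r (s : seq (word r)) (v : word r) :
  lnprod (rcons s v) = wmul (lnprod s) v.
Proof. by rewrite /lnprod foldl_rcons. Qed.

Lemma factorsK r : cancel (@factors r) (@lnprod r).
Proof. by case=> [t|] //=; elim: t => //= u IHu v _; rewrite lnprod_rcons IHu. Qed.

Lemma factors_unique r (i : 'I_r) (s : seq (word r)) :
  wone r \notin s -> factors (lnprod (wletter i :: s)) = wletter i :: s.
Proof.
elim/last_ind: s => [|s v IHs] //.
rewrite mem_rcons in_cons negb_or -rcons_cons lnprod_rcons => /andP[v1 /IHs sE].
case: (lnprod _) sE => [t|] //= sE.
by case: v v1 => [v|] //= _; rewrite sE.
Qed.

(* y^t *)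
Definition wt r (y : word r) : word r := lnprod (rev (factors y)).

(* For words of equal length >= 2, the right factors are compared first. *)
Fixpoint tlt r (u v : tree r) : bool :=
  (tsize u < tsize v) ||
  (tsize u == tsize v) &&
    match u, v with
    | Letter i, Letter j => i < j
    | Node u1 u2, Node v1 v2 => tlt u2 v2 || (u2 == v2) && tlt u1 v1
    | _, _ => false
    end.

Definition wlt r (u v : word r) : bool :=
  match u, v with
  | Some a, Some b => tlt a b
  | None, Some _ => true
  | _, None => false
  end.

Definition wmin r (u v : word r) : word r := if wlt u v then u else v.

(* y_0 = min {y^t, y^tt} *)
Definition wbase r (y : word r) : word r := wmin (wt y) (wt (wt y)).

Definition inD r (z : word r) : Prop :=
  exists y : word r,
    [/\ y <> wone r, z = wbase y, inW y, inW z & inW (wt z) /\ wt z <> z].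

(* [Rn n] is the set R_n for n >= 1; [Rn 0] is a dummy value. *)
Fixpoint Rn r (n : nat) (y : word r) {struct n} : Prop :=
  match n with
  | 0 => False
  | n'.+1 =>
      match n' with
      | 0 => exists i : 'I_r, y = wletter i
      | _ => Rn n' y \/
             [/\ inD y, wsize y <= n &
                 exists us : seq (word r),
                   [/\ us <> [::], forall u, u \in us -> Rn n' u & y = lnprod us]]
      end
  end.

Definition inR r (y : word r) : Prop := exists n : nat, Rn n y.

Definition inB r (y : word r) : Prop :=
  y = wone r \/
  inW y /\ exists ys : seq (word r),
             [/\ ys <> [::], forall u, u \in ys -> inR u & y = lnprod ys].

(* g_1, ..., g_m |-> g_1, g_2, ..., g_m, g_(m-1), ..., g_1 *)
Definition palindrome r (gs : seq (word r)) : seq (word r) := gs ++ behead (rev gs).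

(* Main.v *)
(* W is acted on from the right by the free product of the two-element groups
   generated by the letters R, and 1.(u_1 ... u_k) = pi(u_1 ... u_k); let H be
   the stabiliser of 1.  The theorem says that every coset of H other than H
   that lies over B contains exactly one conjugate of a generator.

   Existence: having a conjugate in H g depends only on the double coset H g H.
   For g = u z this double coset contains the word of g^tt, whose inverse is the
   word of g^t.  If one of these words cancels, induct on the size; otherwise g^t
   and g^tt are equal, hence a palindrome, or one of them is a letter of R.

   Uniqueness: H is malnormal.  Suppose the same cyclically reduced closed word
   is read from two distinct vertices, and let z be a largest vertex visited.  The
   only edges at z that do not lead to a larger vertex are the one erasing its last
   factor and the one labelled z, which joins z to 1; so the word contains the
   label z, and by maximality this is read as z -> 1 on one walk and 1 -> z on the
   other.  From then on one walk reads z backwards while the other climbs along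
   z^t; leaving this course, or completing it, gives a vertex larger than z or
   the vertex z^t, which is as large as z but not in R.  If two palindromes p and q
   both lead from v to v', then the word pq fixes both v and v', so v = v', which is
   impossible. *)
From mathcomp Require Import all_boot.
From mathcomp Require Import zify.
Require Import Defs.

Set Implicit Arguments.
Unset Strict Implicit.
Unset Printing Implicit Defensive.

Section Words.
Variable r : nat.
Implicit Types (a b c t : tree r) (u v w y z : word r) (s l : seq (word r)).

(** * Reduction of a product *)

Lemma tsize_gt0 t : 0 < tsize t.
Proof. by elim: t => //= a IHa b _; rewrite addn_gt0 IHa. Qed.

Lemma wsize_gt0 v : v <> None -> 0 < wsize v.
Proof. by case: v => // t _; apply: tsize_gt0. Qed.

Lemma Node_neql a b : (Node a b == a) = false.
Proof.
by apply/eqP => /(congr1 (@tsize r)) /=; have := tsize_gt0 b; lia.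
Qed.

Lemma Node_neqr a b : (Node a b == b) = false.
Proof.
by apply/eqP => /(congr1 (@tsize r)) /=; have := tsize_gt0 a; lia.
Qed.

Lemma wsize_mul u v : wsize (wmul u v) = wsize u + wsize v.
Proof. by case: u v => [a|] [b|] //=; rewrite addn0. Qed.

Lemma wred_None v : wred None v = v.
Proof. by []. Qed.

Lemma wred_refl v : wred v v = None.
Proof. by case: v => //= a; rewrite eqxx. Qed.

(** An erased last factor can be put back without further reduction, because a word of W is neither
    of the form bb nor (cb)b. So each word of W acts on W as an involution. *)
Lemma wredK u v : inW u -> inW v -> wred (wred u v) v = u.
Proof.
case: u v => [a|] [b|] // Wa Wb; last by rewrite wred_None wred_refl.
have [-> | nab] := eqVneq a b; first by rewrite wred_refl.
rewrite /= (negPf nab); case: a Wa nab => [i|a d] Wa nab.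
  by rewrite /= Node_neqr eqxx.
have [E|ndb] := eqVneq d b; last by rewrite /= Node_neqr eqxx.
move: Wa; rewrite inW_Node /= E negb_or => /and3P[/andP[/negPf-> H] _ _].
by case: a H {nab} => // ? ? /negPf ->.
Qed.

Lemma wred_neq u v : v <> None -> wred u v <> u.
Proof.
case: u v => [a|] [b|] // _ /=; case: eqP => // _.
case: a => [i|a d] //; case: eqP => _ [] //.
  by move=> /esym/eqP; rewrite Node_neql.
by move=> /eqP; rewrite (Node_neql a d).
Qed.

Lemma wred_id u v : inW (wmul u v) -> wred u v = wmul u v.
Proof.
case: u v => [a|] [b|] // W.
have := W; rewrite inW_Node => /and3P[_ Wa Wb].
by have := wpi_mul (Some a) (Some b); rewrite !wpi_id.
Qed.

Definition wlast v := last None (factors v).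

Lemma wlast_Node a b : wlast (Some (Node a b)) = Some b.
Proof. by rewrite /wlast /= last_rcons. Qed.

Lemma wlast_mul u v : v <> None -> u <> None -> wlast (wmul u v) = v.
Proof. by case: u v => [a|] [b|] // _ _; rewrite wlast_Node. Qed.

Lemma wred_up u v : u <> None -> v <> None -> v <> u -> v <> wlast u ->
  wred u v = wmul u v.
Proof.
case: u v => [a|] [b|] // _ _ nba /=; case: eqP => [E|_]; first by rewrite E in nba.
case: a nba => // a d _; rewrite wlast_Node => nbd.
by case: eqP => // E; rewrite E in nbd.
Qed.

Lemma wred_small u v : wred u v = wmul u v \/ wsize (wred u v) < wsize (wmul u v).
Proof.
case: u v => [a|] [b|] //=; try by left.
case: eqP => _; first by right; rewrite addn_gt0 tsize_gt0.
case: a => [i|a d]; first by left.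
by case: eqP => _; [right; rewrite /= -addnA -addn1 leq_add2l addn_gt0 tsize_gt0|left].
Qed.

Lemma inW_mull u v : inW (wmul u v) -> inW u.
Proof. by case: u v => [a|] [b|] //; rewrite inW_Node => /and3P[]. Qed.

Lemma inW_foldl y s : inW (foldl (@wmul r) y s) -> inW y.
Proof. by elim: s y => //= v s IH y /IH /inW_mull. Qed.

(** * Factor lists and transposition *)

Lemma foldl_factors u s : foldl (@wmul r) u s = lnprod (factors u ++ s).
Proof. by rewrite /lnprod foldl_cat -/(lnprod _) factorsK. Qed.

Lemma factors_cat u s : u <> None -> None \notin s ->
  factors (lnprod (factors u ++ s)) = factors u ++ s.
Proof.
case: u => // t _; rewrite -foldl_factors.
elim: s t => [|[c|] s IH] t; rewrite ?cats0 // in_cons //= => ns.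
by rewrite IH //= cat_rcons.
Qed.

Lemma None_factors v : None \notin factors v.
Proof.
case: v => //; elim=> //= a IHa b _.
by rewrite mem_rcons in_cons negb_or.
Qed.

Lemma wsize_lnprod s : wsize (lnprod s) = sumn (map (@wsize r) s).
Proof.
elim/last_ind: s => // s v IH.
by rewrite lnprod_rcons wsize_mul IH map_rcons sumn_rcons.
Qed.

Lemma wsize_wt v : wsize (wt v) = wsize v.
Proof. by rewrite /wt wsize_lnprod map_rev sumn_rev -wsize_lnprod factorsK. Qed.

Lemma factors_eq1 b v : factors (Some b) = [:: v] -> exists i, b = Letter i.
Proof.
case: b => [i|a b] /=; first by exists i.
by case: a => [i|? ?] /(congr1 size) /=; rewrite ?size_rcons.
Qed.

Lemma wt_Node a b :
  wt (Some (Node a b)) = lnprod (factors (Some b) ++ rev (factors (Some a))).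
Proof. by rewrite -foldl_factors /wt /= rev_rcons. Qed.

Lemma factors_wt a b :
  factors (wt (Some (Node a b))) = factors (Some b) ++ rev (factors (Some a)).
Proof. by rewrite wt_Node factors_cat // mem_rev None_factors. Qed.

Lemma wtt_Node a b :
  wt (wt (Some (Node a b))) = lnprod (factors (Some a) ++ rev (factors (Some b))).
Proof. by rewrite {1}/wt factors_wt rev_cat revK. Qed.

Lemma factors_wtt a b : factors (wt (wt (Some (Node a b)))) =
  factors (Some a) ++ rev (factors (Some b)).
Proof. by rewrite wtt_Node factors_cat // mem_rev None_factors. Qed.

(** Only the first transposition can split a factor: its result ends in a letter, so the next
    reversal starts with a letter and keeps all factors whole. *)
Lemma wttt v : wt (wt (wt v)) = wt v.
Proof.
case: v => // -[i|a b] //.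
by rewrite {1}/wt factors_wtt rev_cat revK wt_Node.
Qed.

(** * The order on words and the set D *)

Lemma tlt_asym a b : tlt a b -> ~~ tlt b a.
Proof.
elim: a b => [i|a1 IH1 a2 IH2] [j|b1 b2] /=; rewrite ?andbF ?orbF.
- by rewrite -leqNgt => /ltnW.
- by rewrite -leqNgt => /ltnW.
- by rewrite -leqNgt => /ltnW.
case: (ltngtP (tsize a1 + tsize a2) (tsize b1 + tsize b2)) => //= _.
case/orP=> [lt2|/andP[/eqP E lt1]].
  rewrite (negPf (IH2 _ lt2)) /= negb_and; apply/orP; left.
  by apply: contraL lt2 => /eqP->; apply/negP => H; move: (IH2 _ H); rewrite H.
rewrite E eqxx (negPf (IH1 _ lt1)) orbF.
by subst b2; apply/negP => H; move: (IH2 _ H); rewrite H.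
Qed.

Lemma tlt_total a b : a <> b -> tlt a b || tlt b a.
Proof.
elim: a b => [i|a1 IH1 a2 IH2] [j|b1 b2] /=.
- move=> nij; case: (ltngtP i j) => //= E; case: nij; congr Letter; exact: val_inj.
- by rewrite -(addn1 1) leq_add ?tsize_gt0.
- by rewrite orbC -(addn1 1) leq_add ?tsize_gt0.
move=> nab; case: (ltngtP (tsize a1 + tsize a2) (tsize b1 + tsize b2)) => //= _.
have [E|/eqP n2] := eqVneq a2 b2; last by case/orP: (IH2 _ n2) => ->; rewrite ?orbT.
have n1 : a1 <> b1 by move=> E1; apply: nab; rewrite E E1.
by case/orP: (IH1 _ n1) => ->; rewrite ?orbT.
Qed.

Lemma wlt_asym u v : wlt u v -> ~~ wlt v u.
Proof. by case: u v => [a|] [b|] //; apply: tlt_asym. Qed.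

Lemma wlt_total u v : u <> v -> wlt u v || wlt v u.
Proof.
case: u v => [a|] [b|] //= n; apply: tlt_total => E; by rewrite E in n.
Qed.

(** By [wttt] the words y^t and y^tt are transposes of each other, so the minimum picks the smaller
    word of a transposed pair. *)
Lemma inD_spec z : inD z ->
  [/\ inW z, inW (wt z), wt z <> z, wt (wt z) = z & wlt z (wt z)].
Proof.
case=> y [y1 zE _ Wz [Wtz ntz]]; split=> //; move: zE; rewrite /wbase /wmin.
  by case: ifP => _ ->; rewrite wttt.
case: ifP => [lt ->|lt E] //.
have tE : wt z = wt y by rewrite E wttt.
rewrite -E -tE in lt.
by have := wlt_total ntz; rewrite lt.
Qed.

(** * The set R *)

Lemma inR_letter i : inR (wletter i : word r).
Proof. by exists 1, i. Qed.

Lemma Rn_S n y : Rn n y -> Rn n.+1 y.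
Proof. by case: n => // n H; left. Qed.

Lemma Rn_le m n y : m <= n -> Rn m y -> Rn n y.
Proof. by move=> /subnK <-; elim: (n - m) => // k IH /IH /Rn_S. Qed.

Lemma Rn_bound s : (forall v, v \in s -> inR v) ->
  exists n, forall v, v \in s -> Rn n v.
Proof.
elim: s => [|v s IH] H; first by exists 0.
have [n Hn] := IH (fun v vs => H v (mem_behead (s := _ :: _) vs)).
have [m Hm] := H v (mem_head _ _).
exists (maxn m n) => u; rewrite in_cons => /orP[/eqP->|/Hn].
  by apply: Rn_le Hm; rewrite leq_maxl.
by apply: Rn_le; rewrite leq_maxr.
Qed.

Lemma inR_D y : inD y -> (forall v, v \in factors y -> inR v) -> inR y.
Proof.
(* Two successors are needed to reach the inductive clause, since stage 1 is the base case and stage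
   0 a dummy. *)
move=> Dy /Rn_bound[n Hn]; exists (maxn n (wsize y)).+2; right; split=> //.
  by rewrite ltnW // ltnS ltnW // ltnS leq_maxr.
exists (factors y); split=> [E||]; last by rewrite factorsK.
  have yE := factorsK y; rewrite E in yE.
  by case: (inD_spec Dy); rewrite -yE.
by move=> v /Hn; apply: Rn_le; rewrite ltnW // ltnS leq_maxl.
Qed.

Lemma inR_cases y : inR y -> (exists i, y = wletter i) \/ inD y.
Proof.
case=> n; elim: n => // -[|n] IH; first by left.
by case=> [/IH|[Dy _ _]] //; right.
Qed.

Lemma inR_neq y : inR y -> y <> None.
Proof. by move=> /inR_cases[[i -> //]|/inD_spec[_ _ H _ _] E]; rewrite E in H. Qed.

Lemma inR_W y : inR y -> inW y.
Proof. by move=> /inR_cases[[i -> //]|/inD_spec[]]. Qed.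

Lemma None_inR s : (forall v, v \in s -> inR v) -> None \notin s.
Proof. by move=> H; apply/negP => /H /inR_neq. Qed.

(** Only the first term of a left-normed product is split into its factors; the later terms remain
    factors as they are. *)
Lemma inR_lnprod_factors s :
    (forall u, u \in s -> inR u) ->
    (forall u, u \in s -> forall v, v \in factors u -> inR v) ->
  forall v, v \in factors (lnprod s) -> inR v.
Proof.
case: s => // u s sR sF v.
have -> : lnprod (u :: s) = lnprod (factors u ++ s) by rewrite -foldl_factors.
rewrite factors_cat; last 2 first.
- by apply/inR_neq/sR; rewrite mem_head.
- by apply: None_inR => w ws; apply: sR; rewrite in_cons ws orbT.
rewrite mem_cat => /orP[|vs]; first by apply: sF; rewrite mem_head.
by apply: sR; rewrite in_cons vs orbT.
Qed.

Lemma inR_factors y : inR y -> forall v, v \in factors y -> inR v.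
Proof.
case=> n; elim: n y => // -[|n] IH y.
  by case=> i -> v; rewrite /= inE => /eqP->; apply: inR_letter.
case=> [/IH //|[_ _ [us [_ usR ->]]]]; apply: inR_lnprod_factors => u /usR.
  by exists n.+1.
exact: IH.
Qed.

(** Comparing the factors of z^tt = z shows that the factor list of b, reversed, is b alone, so b is
    a letter. If z^t were in R as well, it would be in D, giving z < z^t < z. *)
Lemma inR_Node a b : inR (Some (Node a b)) ->
  [/\ exists i, b = Letter i, inW (wt (Some (Node a b))),
      wt (Some (Node a b)) <> Some (Node a b) & ~ inR (wt (Some (Node a b)))].
Proof.
move=> /inR_cases[[i //]|D]; have [Wz Wtz ntz ttz lt] := inD_spec D; split=> //.
  have := congr1 (@factors r) ttz; rewrite factors_wtt /= -cats1 => /eqP.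
  rewrite eqseq_cat // eqxx /= => /eqP H.
  apply: (@factors_eq1 _ (Some b)).
  by rewrite -[LHS]revK /= H.
move=> /inR_cases[[i tE]|/inD_spec[_ _ _ _]].
  by move: ttz; rewrite tE.
by rewrite ttz; apply/negP/wlt_asym.
Qed.

(** * The right action on W *)

Definition act y l := foldl (@wred r) y l.

Definition allR l := forall v, v \in l -> inR v.

Lemma allR_cons v l : allR (v :: l) <-> inR v /\ allR l.
Proof.
split=> [H|[Hv Hl] u].
  by split=> [|u ul]; apply: H; rewrite ?mem_head // in_cons ul orbT.
by rewrite in_cons => /orP[/eqP->|/Hl].
Qed.

Lemma allR_cat l1 l2 : allR (l1 ++ l2) <-> allR l1 /\ allR l2.
Proof.
split=> [H|[H1 H2] u]; last by rewrite mem_cat => /orP[/H1|/H2].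
by split=> u ul; apply: H; rewrite mem_cat ul ?orbT.
Qed.

Lemma allR_rev l : allR (rev l) <-> allR l.
Proof. by split=> H u; have := H u; rewrite mem_rev. Qed.

Lemma act_cat y l1 l2 : act y (l1 ++ l2) = act (act y l1) l2.
Proof. exact: foldl_cat. Qed.

Lemma act_rcons y l v : act y (rcons l v) = wred (act y l) v.
Proof. exact: foldl_rcons. Qed.

Lemma act_W y l : allR l -> inW y -> inW (act y l).
Proof.
elim: l y => //= v l IH y /allR_cons[vR lR] Wy; apply: IH => //.
by apply: inW_wred => //; apply: inR_W.
Qed.

(** Generators are involutions by [wredK], so reversing a list inverts its action. *)
Lemma act_revK y l : allR l -> inW y -> act (act y l) (rev l) = y.
Proof.
elim: l y => //= v l IH y /allR_cons[vR lR] Wy.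
have Wv := inR_W vR.
by rewrite rev_cons act_rcons IH ?wredK // inW_wred.
Qed.

Lemma wpi_lnprod l : allR l -> wpi (lnprod l) = act None l.
Proof.
elim/last_ind: l => // l v IH; rewrite -cats1 => /allR_cat[lR /allR_cons[vR _]].
by rewrite cats1 lnprod_rcons wpi_mul IH // act_rcons wpi_id ?inR_W.
Qed.

Lemma wsize_foldl y l : wsize (foldl (@wmul r) y l) = wsize y + sumn (map (@wsize r) l).
Proof.
by rewrite foldl_factors wsize_lnprod map_cat sumn_cat -wsize_lnprod factorsK.
Qed.

(** A reduction anywhere loses letters, and the later terms add at most their sizes. This drop
    drives the induction in [conjugate_B]. *)
Lemma act_small y l :
  act y l = foldl (@wmul r) y l \/ wsize (act y l) < wsize (foldl (@wmul r) y l).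
Proof.
elim: l y => [|v l IH] y /=; first by left.
have [->|lt1] := wred_small y v; first exact: IH.
right; have [->|lt2] := IH (wred y v); last apply: ltn_trans lt2 _;
  by rewrite !wsize_foldl ltn_add2r.
Qed.

Lemma act_lnprod l : act None l = lnprod l \/ wsize (act None l) < wsize (lnprod l).
Proof. exact: act_small. Qed.

Lemma act_factors y : inW y -> act None (factors y) = y.
Proof.
case: y => //; elim=> //= a IHa b _ W.
have := W; rewrite inW_Node => /and3P[_ Wa Wb].
rewrite act_rcons IHa //; exact: (@wred_id (Some a) (Some b)).
Qed.

Lemma allR_wred y v :
  allR (factors y) -> inR v -> allR (factors (wred y v)).
Proof.
case: y v => [a|] [b|] // Fa Rb; last exact: inR_factors.
have FN t : allR (tfactors t) -> allR (rcons (tfactors t) (Some b)).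
  by move=> Ft; rewrite -cats1; apply/allR_cat; split=> //; apply/allR_cons.
rewrite /=; case: eqP => // _; case: a Fa => [i|a d] Fa; first exact: (FN _ Fa).
case: eqP => _; last exact: (FN _ Fa).
by move: Fa; rewrite /= -cats1 => /allR_cat[].
Qed.

Lemma allR_act y l : allR (factors y) -> allR l -> allR (factors (act y l)).
Proof.
elim: l y => //= v l IH y Fy /allR_cons[Rv Rl].
by apply: IH => //; apply: allR_wred.
Qed.

(** * Existence: conjugates of generators *)

Definition conjugate g := exists2 l : seq (word r) * word r,
  allR l.1 /\ inR l.2 & g = act None (l.1 ++ l.2 :: rev l.1).

(** If the conjugate p sends 1 to g and l fixes 1, then l^-1 p l is a conjugate sending 1 to g.l. *)
Lemma conjugate_stab g l : conjugate g -> allR l -> act None l = None ->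
  conjugate (act g l).
Proof.
case=> -[w v] /= [Rw Rv] -> Rl l1; exists (rev l ++ w, v) => /=.
  by split=> //; apply/allR_cat; split=> //; apply/allR_rev.
have l1' : act None (rev l) = None by rewrite -{1}l1 act_revK.
by rewrite rev_cat revK -cat_cons catA [RHS]act_cat -catA [act None (rev l ++ _)]act_cat l1'.
Qed.

Lemma conjugate_R v : inR v -> conjugate v.
Proof. by move=> Rv; exists ([::], v). Qed.

(** Let p be a conjugate with 1.p = 1.l^-1. Then p l fixes 1, and it sends 1.l^-1 through 1 to 1.l,
    so [conjugate_stab] applies. *)
Lemma conjugate_rev l : allR l -> conjugate (act None (rev l)) ->
  conjugate (act None l).
Proof.
move=> Rl H; have [[w v] /= [Rw Rv] E] := H.
set p := w ++ v :: rev w in E.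
have Rp : allR p.
  by apply/allR_cat; split=> //; apply/allR_cons; split=> //; apply/allR_rev.
have pp : rev p = p by rewrite rev_cat rev_cons revK cat_rcons.
move: p Rp pp E => p Rp pp E; have := conjugate_stab (l := p ++ l) H; rewrite !act_cat.
have -> : act (act None (rev l)) p = None by rewrite E -{2}pp act_revK.
apply; first exact/allR_cat.
rewrite -E -{2}(revK l) act_revK //; exact/allR_rev.
Qed.

(** A palindrome of odd length is a conjugate of its middle entry; one of even length acts trivially
    and would fix 1. *)
Lemma palindrome_act l : allR l -> rev l = l -> act None l <> None ->
  conjugate (act None l).
Proof.
move=> Rl revl l1.
have [p [l2 [lE sl]]] : exists p l2, l = p ++ l2 ++ rev p /\ size l2 = odd (size l).
  exists (take (size l)./2 l), (take (odd (size l)) (drop (size l)./2 l)); split.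
    rewrite -[LHS](cat_take_drop (size l)./2); congr (_ ++ _).
    rewrite -[LHS](cat_take_drop (odd (size l))); congr (_ ++ _).
    rewrite drop_drop rev_take revl; congr drop.
    by have := odd_double_half (size l); lia.
  rewrite size_takel // size_drop.
  by have := odd_double_half (size l); lia.
rewrite lE in Rl; case/allR_cat: Rl => Rp /allR_cat[Rl2 _].
case: l2 => [|v [|? ?]] in lE sl Rl2 *; last by move: sl; case: odd.
  by case: l1; rewrite lE act_cat act_revK.
by rewrite lE; exists (p, v) => //=; case/allR_cons: Rl2.
Qed.

Lemma conjugate_B g : inW g -> g <> None -> allR (factors g) -> conjugate g.
Proof.
have [n] := ubnP (wsize g); elim: n g => // n IH [[i|a b]|] // sg Wg _ Rg.
  exact/conjugate_R/inR_letter.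
have := Wg; rewrite inW_Node => /and3P[_ Wa Wb].
move: (Rg); rewrite /= -cats1 => /allR_cat[Ra /allR_cons[Rb _]].
have Rfb := inR_factors Rb.
(* [l] spells g^tt and [rev l] spells g^t. *)
pose l := factors (Some a) ++ rev (factors (Some b)).
have Rl : allR l by apply/allR_cat; split=> //; apply/allR_rev.
have Rrl : allR (rev l) by apply/allR_rev.
(* If 1.l were 1, applying the factors of b would give a = b, so g would have the form bb. *)
have lN : act None l <> None.
  rewrite act_cat act_factors // => /(congr1 (fun y => act y (factors (Some b)))).
  rewrite -{2}(revK (factors (Some b))) act_revK //; last exact/allR_rev.
  rewrite act_factors // => -[E].
  by move: Wg; rewrite inW_Node E /= eqxx.
have rlN : act None (rev l) <> None.
  move=> /(congr1 (fun y => act y l)).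
  by rewrite -{2}(revK l) act_revK // => /esym.
suff Hl : conjugate (act None l).
  (* The factors of b followed by b itself form a list that fixes 1 and leads from 1.l to g. *)
  have -> : Some (Node a b) = act (act None l) (rcons (factors (Some b)) (Some b)).
    rewrite act_cat act_factors // act_rcons -{2}(revK (factors (Some b))).
    rewrite act_revK //; last exact/allR_rev.
    by rewrite (@wred_id (Some a) (Some b)).
  apply: conjugate_stab => //.
    by rewrite -cats1; apply/allR_cat; split=> //; apply/allR_cons.
  by rewrite act_rcons act_factors // wred_refl.
have sl : wsize (lnprod l) <= n by rewrite -wtt_Node !wsize_wt.
have srl : wsize (lnprod (rev l)) <= n.
  by rewrite wsize_lnprod map_rev sumn_rev -wsize_lnprod.
case: (act_lnprod l) => [lE|lt]; last first.
  by apply: IH => //; [lia|apply: act_W|apply: allR_act].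
apply: conjugate_rev => //.
case: (act_lnprod (rev l)) => [rlE|lt]; last first.
  by apply: IH => //; [lia|apply: act_W|apply: allR_act].
have [ll|nll] := eqVneq (rev l) l.
  by rewrite ll; apply: palindrome_act.
have Wl : inW (lnprod l) by rewrite -lE; apply: act_W.
have Wrl : inW (lnprod (rev l)) by rewrite -rlE; apply: act_W.
have tE : wt (Some (Node a b)) = lnprod (rev l) by rewrite wt_Node rev_cat revK.
have ttE : wt (wt (Some (Node a b))) = lnprod l by rewrite wtt_Node.
have nE : lnprod l <> lnprod (rev l).
  rewrite -tE -ttE => /(congr1 (@factors r)).
  by rewrite factors_wtt factors_wt => E; move: nll; rewrite /l E rev_cat revK -E eqxx.
have tl : wt (lnprod l) = lnprod (rev l) by rewrite -ttE wttt tE.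
have trl : wt (lnprod (rev l)) = lnprod l by rewrite -tE.
have Fl : factors (lnprod l) = l by rewrite -ttE factors_wtt.
have Frl : factors (lnprod (rev l)) = rev l by rewrite -tE factors_wt rev_cat revK.
(* Both words are now reduced and distinct, so the smaller one is in D, and its factors are in R. *)
have Db : inD (wbase (Some (Node a b))).
  exists (Some (Node a b)); rewrite /wbase /wmin ttE tE; split=> //; case: ifP => _ //.
    by rewrite trl.
  by rewrite tl; split=> // /esym.
move: Db; rewrite /wbase /wmin ttE tE; case: ifP => _ D.
  by rewrite rlE; apply/conjugate_R/inR_D => //; rewrite Frl.
apply: conjugate_rev => //; rewrite revK lE; apply/conjugate_R/inR_D => //.
by rewrite Fl.
Qed.


(** * Two bounded walks with the same labels *)

Section Walks.
Variables (l : nat -> word r) (M : nat).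
Hypothesis lR : forall i, inR (l i).
Hypothesis l_reduced : forall i, l i <> l i.+1.

(** Walks are infinite, so that a closed walk can be read periodically; the bound [M] forbids
    unlimited growth. *)
Definition walk (x : nat -> word r) :=
  forall i, [/\ inW (x i), x i.+1 = wred (x i) (l i) & wsize (x i) <= M].

Implicit Types x : nat -> word r.

Let l_neq i : l i <> None. Proof. exact: inR_neq. Qed.

Lemma walk_up x i : walk x -> x i <> None -> l i <> x i -> l i <> wlast (x i) ->
  x i.+1 = wmul (x i) (l i).
Proof. by move=> X xN nx nlast; have [_ -> _] := X i; apply: wred_up. Qed.

(** A label other than the vertex and its last factor would lead beyond size [M], and this holds for
    both neighbours. The two labels differ, so one of them is the vertex itself, which therefore
    lies in R. *)
Lemma walk_top x i : walk x -> wsize (x i.+1) = M ->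
  [/\ exists a b, x i.+1 = Some (Node a b), inR (x i.+1) &
     l i = x i.+1 /\ l i.+1 = wlast (x i.+1) \/
     l i = wlast (x i.+1) /\ l i.+1 = x i.+1].
Proof.
move=> X sx; set y := x i.+1 in sx *.
have [Wxi yE s1] := X i; have [Wy _ s2] := X i.+1; have [_ zE s3] := X i.+2.
rewrite -/y in yE s2 Wy.
have yN : y <> None.
  (* At the vertex 1 the bound [M] would be 0, but the next vertex is a generator. *)
  move=> E; have [_ yE' s2'] := X i.+1; have [_ _ s4] := X i.+2.
  move: s4; rewrite yE' -/y E wred_None -sx E.
  by have := wsize_gt0 (l_neq (i := i.+1)); case: wsize.
have top v : v <> None -> wsize (wred y v) <= M -> v = y \/ v = wlast y.
  move=> vN sv; have [|/eqP ny] := eqVneq v y; first by left.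
  have [|/eqP nl] := eqVneq v (wlast y); first by right.
  move: sv; rewrite wred_up // wsize_mul sx.
  by have := wsize_gt0 vN; lia.
have top1 : l i = y \/ l i = wlast y.
  by apply: top; rewrite // yE wredK // inR_W.
have top2 : l i.+1 = y \/ l i.+1 = wlast y.
  by apply: top => //; have [_ E _] := X i.+1; rewrite -E; have [] := X i.+2.
have yNode : exists a b, y = Some (Node a b).
  case: (y) yN top1 top2 => [[j|a b]|] //; last by exists a, b.
  rewrite /wlast /= => _ top1 top2; case: (l_reduced (i := i)).
  by have -> : l i = Some (Letter j) by [case: top1]; case: top2.
have := l_reduced (i := i); case: top1 top2 => [E1|E1] [E2|E2] n; first by rewrite E1 E2 in n.
- by split=> //; [rewrite -E1|left].
- by split=> //; [rewrite -E2|right].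
by rewrite E1 E2 in n.
Qed.

(** While the label equals neither vertex, both walks append it and stay distinct, which cannot go
    on below the bound. When it equals one vertex u, the other vertex is multiplied by u. A product
    of size [M] would be in R, making u a letter and so its own last factor, which is excluded. *)
Lemma climb x x' i : walk x -> walk x' ->
    x i <> None -> x' i <> None -> x i <> x' i ->
    l i <> wlast (x i) -> l i <> wlast (x' i) ->
  wsize (x i) + wsize (x' i) < M.
Proof.
have special u x1 j : walk x1 -> u <> None -> l j = u -> l j <> x1 j ->
    l j <> wlast u -> x1 j <> None -> l j <> wlast (x1 j) ->
    wsize u + wsize (x1 j) < M.
  move=> X uN uE nx nlu xN nlx; rewrite ltnNge; apply/negP => s.
  have E := walk_up X xN nx nlx; have [_ _ s'] := X j.+1.
  have sE : wsize (x1 j.+1) = M.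
    by apply/eqP; rewrite eqn_leq s' E wsize_mul uE addnC.
  have [[a [b xE]] xR _] := walk_top X sE; rewrite xE in xR.
  have [[k bE] _ _ _] := inR_Node xR; have := wlast_Node a b.
  rewrite -xE E wlast_mul // bE => lE.
  by apply: nlu; rewrite -uE lE.
move=> X X'; have [n] := ubnP (M - wsize (x i)).
elim: n i => // n IH i sn xN x'N nxx' nlx nlx'.
have [E|/eqP nx] := eqVneq (l i) (x i).
  by apply: special; rewrite // E.
have [E|/eqP nx'] := eqVneq (l i) (x' i).
  by rewrite addnC; apply: special; rewrite // E.
have E := walk_up X xN nx nlx; have E' := walk_up X' x'N nx' nlx'.
have l0 := wsize_gt0 (l_neq (i := i)).
have [_ _ s1] := X i.+1.
have lastE : wlast (x i.+1) = l i by rewrite E wlast_mul.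
have lastE' : wlast (x' i.+1) = l i by rewrite E' wlast_mul.
suff : wsize (x i.+1) + wsize (x' i.+1) < M by rewrite E E' !wsize_mul; lia.
apply: IH; rewrite ?lastE ?lastE'; try by move/esym; apply: l_reduced.
- by move: s1; rewrite E wsize_mul; lia.
- by rewrite E; case: (x i) (l i) xN (l_neq (i := i)) => [?|] [?|].
- by rewrite E'; case: (x' i) (l i) x'N (l_neq (i := i)) => [?|] [?|].
rewrite E E'; move: nxx' xN x'N (l_neq (i := i)).
by case: (x i) (x' i) (l i) => [a|] [b|] [d|] // n1 _ _ _ [E1]; rewrite E1 in n1.
Qed.

Lemma wsize_factors y : wsize y = sumn (map (@wsize r) (factors y)).
Proof. by rewrite -wsize_lnprod factorsK. Qed.

Lemma factors_last y : y <> None -> exists s, factors y = rcons s (wlast y).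
Proof.
rewrite /wlast; case: y => [t|] // _; case/lastP: (factors _) (factorsK (Some t)) => // s v _.
by exists s; rewrite last_rcons.
Qed.

(* [x] reads [z] backwards while [x'] reads its transpose forwards. *)
Lemma descend x x' z a s i : walk x -> walk x' ->
    inR z -> inW (wt z) -> wt z <> z -> ~ inR (wt z) -> wsize z = M ->
    x i = Some a -> s <> [::] -> factors z = factors (Some a) ++ s ->
    factors (x' i) = rev s -> l i <> wlast (x' i) ->
  False.
Proof.
move=> X X' zR Wtz ntz tzR zM.
have step b s' j : x j = Some b -> s' <> [::] -> factors z = factors (Some b) ++ s' ->
    factors (x' j) = rev s' -> l j <> wlast (x' j) ->
    l j = wlast (x j) /\ x' j.+1 = wmul (x' j) (l j).
  move=> xE sN zE x'E nl.
  have x'N : x' j <> None by move=> E; apply: sN; rewrite -(revK s') -x'E E.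
  (* The two sizes add up to [M], so [climb] rules out any other label. Equal vertices would make z
     its own transpose. *)
  have lE : l j = wlast (x j).
    apply/eqP; apply: contraT => /eqP nlx; suff: wsize (x j) + wsize (x' j) < M.
      rewrite xE !wsize_factors x'E map_rev sumn_rev -sumn_cat -map_cat -zE.
      by rewrite -wsize_factors zM ltnn.
    apply: climb => //; first by rewrite xE.
    rewrite xE => E; apply: ntz; rewrite /wt zE E x'E rev_cat revK -x'E -E -zE.
    by rewrite factorsK.
  (* The product is an initial part of z^t, which is in W. *)
  split=> //; have [_ -> _] := X' j; apply: wred_id.
  have [f fE] : exists f, factors (Some b) = rcons f (l j).
    by rewrite lE xE; apply: factors_last.
  apply: (inW_foldl (s := rev f)); move: Wtz.
  by rewrite /wt zE fE rev_cat rev_rcons -x'E -foldl_factors.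
(* Once [a] is a letter, the next vertex of [x'] is z^t, of size [M], and [walk_top] would put it in
   R. *)
elim: a s i => [j|a IHa b _] s i xE sN zE x'E nl; have [lE x'S] := step _ _ _ xE sN zE x'E nl.
  have lj : l i = Some (Letter j) by rewrite lE xE.
  have tzE : x' i.+1 = wt z.
    by rewrite x'S -(factorsK (x' i)) x'E lj -lnprod_rcons /wt zE /= rev_cons.
  by have [|_ + _] := walk_top (i := i) X'; rewrite tzE // wsize_wt.
have lb : l i = Some b by rewrite lE xE wlast_Node.
have x'N : x' i <> None by move=> E; apply: sN; rewrite -(revK s) -x'E E.
apply: (IHa (Some b :: s) i.+1) => //.
- have [Wx -> _] := X i; rewrite xE lb in Wx *.
  by rewrite /= Node_neqr eqxx.
- by rewrite zE /= cat_rcons.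
- rewrite x'S lb rev_cons -x'E; case: (x' i) x'N => //.
by rewrite x'S wlast_mul // => /esym; apply: l_reduced.
Qed.

(** A product with z as right factor and nonempty left factor exceeds [M], so it is neither the
    start nor the end of the edge. *)
Lemma special_label x i z : walk x -> l i = z -> wsize z = M ->
  x i = None /\ x i.+1 = z \/ x i = z /\ x i.+1 = None.
Proof.
move=> X lE zM; have [Wx xS sx] := X i; have [_ _ sx'] := X i.+1.
have [E|/eqP nx] := eqVneq (x i) None; first by left; rewrite xS E.
have [E|/eqP nz] := eqVneq (x i) z; first by right; rewrite xS E lE wred_refl.
have zN : z <> None by rewrite -lE.
have [E|/eqP nl] := eqVneq z (wlast (x i)).
  case: (x i) nx nz E sx => [[j|a b]|] //; first by rewrite /wlast /= => _ nz E; rewrite E in nz.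
  rewrite wlast_Node -zM => _ _ -> /=; by have := tsize_gt0 a; lia.
move: sx'; rewrite (walk_up X) ?lE ?wsize_mul ?zM => // [|/esym //].
by have := wsize_gt0 nx; lia.
Qed.

Lemma walks_meet x x' i : walk x -> walk x' -> wsize (x i.+1) = M ->
  exists j, x j = x' j.
Proof.
move=> X X' sx; have [_ zR top] := walk_top X sx.
set z := x i.+1 in sx zR top.
have [j lj] : exists j, l j = z.
  by case: top => -[E1 E2]; [exists i | exists i.+1].
(* Opposite directions along z: the next label is the last factor b of z, a letter. One walk drops
   it from z, the other arrives at b, the start of z^t, and [descend] applies. *)
have core x1 x2 : walk x1 -> walk x2 -> x1 j.+1 = z -> x2 j.+1 = None -> False.
  move=> X1 X2 E1 E2.
  have top1 := walk_top X1 (i := j); rewrite E1 in top1.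
  have [[a [b zE]] _ [[_ lE]|[_ lE]]] := top1 sx.
    have x1E : x1 j.+2 = Some a.
      by have [_ -> _] := X1 j.+1; rewrite E1 lE zE wlast_Node /= Node_neqr eqxx.
    rewrite zE in zR; have [[k bE] Wtz ntz tzR] := inR_Node zR.
    have x2E : x2 j.+2 = Some b.
      by have [_ -> _] := X2 j.+1; rewrite E2 lE zE wlast_Node.
    apply: (descend X1 X2 zR Wtz ntz tzR _ x1E (s := [:: Some b])) => //.
    - by rewrite -zE.
    - by rewrite /= cats1.
    - by rewrite x2E bE.
    have -> : wlast (x2 j.+2) = l j.+1 by rewrite x2E lE zE wlast_Node bE.
    by move/esym; apply: l_reduced.
  by case: (l_reduced (i := j)); rewrite lj lE.
have [[E1 E1']|[E1 E1']] := special_label X lj sx;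
have [[E2 E2']|[E2 E2']] := special_label X' lj sx.
- by exists j; rewrite E1 E2.
- by case: (core x x').
- by case: (core x' x).
by exists j; rewrite E1 E2.
Qed.

End Walks.

(** * Closed walks *)

Notation neq := (fun u v : word r => u != v).

Lemma modn_succ n i : 0 < n ->
  (i %% n).+1 < n /\ i.+1 %% n = (i %% n).+1 \/
  (i %% n).+1 = n /\ i.+1 %% n = 0.
Proof.
move=> n0; have -> : i.+1 %% n = (i %% n).+1 %% n by rewrite -addn1 -modnDml addn1.
have := ltn_pmod i n0; rewrite leq_eqVlt => /orP[/eqP->|lt].
  by right; rewrite modnn.
by left; rewrite [_.+1 %% n]modn_small.
Qed.

(** Since [cycle] also compares the last entry with the first, the periodic extension is reduced
    where it wraps around. *)
Lemma cycle_nth s i : cycle neq s -> s <> [::] ->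
  nth None s (i %% size s) <> nth None s (i.+1 %% size s).
Proof.
case: s => // v s /(pathP None) H _; set n := size _.
have lt_in : i %% n < n by rewrite ltn_mod.
have := H (i %% n); rewrite size_rcons => /(_ lt_in) /eqP.
rewrite -rcons_cons nth_rcons lt_in nth_rcons.
case: (@modn_succ n i) => // -[+ ->]; first by rewrite ltnS => ->.
by case=> ->; rewrite ltnn eqxx.
Qed.

(* Malnormality of the stabiliser of [1]. *)
Lemma act_fix_unique s u v : s <> [::] -> allR s -> cycle neq s ->
  inW u -> inW v -> act u s = u -> act v s = v -> u = v.
Proof.
move=> sN sR sC Wu Wv fu fv; set n := size s.
have n0 : 0 < n by rewrite lt0n size_eq0; apply/eqP.
pose l i := nth None s (i %% n).
pose x y i := act y (take (i %% n) s).
have takeR i : allR (take i s) by move=> w /mem_take; apply: sR.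
have lR i : inR (l i) by apply/sR/mem_nth; rewrite ltn_mod.
pose F i := maxn (wsize (x u i)) (wsize (x v i)).
pose m := [arg max_(i > Ordinal n0) F i].
have Fm i : F i <= F m.
  have -> : F i = F (Ordinal (ltn_pmod i n0)) by rewrite /F /x /= modn_mod.
  by rewrite /m; case: arg_maxnP => // j _; apply.
have xW y : inW y -> act y s = y -> (forall i, wsize (x y i) <= F m) ->
    walk l (F m) (x y).
  move=> Wy fy B i; split=> //; first exact: act_W.
  have lt_in : i %% n < n by rewrite ltn_mod.
  have -> : wred (x y i) (l i) = act y (take (i %% n).+1 s).
    by rewrite (take_nth None) // act_rcons.
  by rewrite /x; case: (@modn_succ n i n0) => -[E ->] //; rewrite E take0 take_size fy.
have Xu : walk l (F m) (x u).
  by apply: xW => // i; apply: leq_trans (Fm i); apply: leq_maxl.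
have Xv : walk l (F m) (x v).
  by apply: xW => // i; apply: leq_trans (Fm i); apply: leq_maxr.
have l_red i : l i <> l i.+1 by apply: cycle_nth.
(* [walks_meet] expects the largest vertex at a successor index; moving on by one period provides
   it. *)
have period y : x y (m + n.-1).+1 = x y m by rewrite /x -addnS prednK // modnDr.
have [j E] : exists j, x u j = x v j.
  have [lt|le] := leqP (wsize (x u m)) (wsize (x v m)).
    have [|j E] := walks_meet (i := m + n.-1) lR l_red Xv Xu; last by exists j.
    by rewrite period /F; apply/esym/maxn_idPr.
  apply: (walks_meet (i := m + n.-1) lR l_red Xu Xv).
  by rewrite period /F; apply/esym/maxn_idPl/ltnW.
(* From the common vertex, the same labels read backwards lead to both u and v. *)
by rewrite -(act_revK (takeR (j %% n)) Wu) -(act_revK (takeR (j %% n)) Wv); congr act.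
Qed.

(** * Palindromes and uniqueness *)

Lemma palindrome_rcons s v : palindrome (rcons s v) = s ++ v :: rev s.
Proof. by rewrite /palindrome rev_rcons cat_rcons. Qed.

Lemma palindrome_cons v s : s <> [::] ->
  palindrome (v :: s) = v :: rcons (palindrome s) v.
Proof.
case/lastP: s => // s w _.
by rewrite -rcons_cons !palindrome_rcons rev_cons -rcons_cons -rcons_cat.
Qed.

Lemma act_palindrome_cons y v s : s <> [::] ->
  act y (palindrome (v :: s)) = wred (act (wred y v) (palindrome s)) v.
Proof. by move=> sN; rewrite palindrome_cons // -act_rcons. Qed.

Lemma palindrome_rev s : rev (palindrome s) = palindrome s.
Proof.
by case/lastP: s => // s v; rewrite palindrome_rcons rev_cat rev_cons revK cat_rcons.
Qed.

Lemma palindrome_head v s : exists2 p, palindrome (v :: s) = v :: p & last v p = v.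
Proof.
case: s => [|w s]; first by exists [::].
exists (rcons (palindrome (w :: s)) v); first by rewrite palindrome_cons.
by rewrite last_rcons.
Qed.

Lemma palindrome_sorted s : sorted neq s -> sorted neq (palindrome s).
Proof.
elim: s => // v [|w s] // IH /andP[nvw ps].
have [p pE lp] := palindrome_head w s.
rewrite palindrome_cons // pE /= rcons_path lp nvw eq_sym nvw andbT.
by move: (IH ps); rewrite pE.
Qed.

Lemma allR_palindrome s : allR s -> allR (palindrome s).
Proof.
case/lastP: s => // s v; rewrite palindrome_rcons -cats1.
case/allR_cat=> Rs /allR_cons[Rv _]; apply/allR_cat; split=> //.
by apply/allR_cons; split=> //; apply/allR_rev.
Qed.

Lemma act_palindromeK y s : allR s -> inW y ->
  act (act y (palindrome s)) (palindrome s) = y.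
Proof.
by move=> Rs Wy; rewrite -{2}palindrome_rev act_revK //; apply: allR_palindrome.
Qed.

(** The palindrome is a conjugate of a generator, and generators have no fixed vertex by
    [wred_neq]. *)
Lemma act_palindrome_neq y s : s <> [::] -> allR s -> inW y ->
  act y (palindrome s) <> y.
Proof.
case/lastP: s => // s v _ Rsv Wy; move: Rsv; rewrite palindrome_rcons -cats1.
case/allR_cat=> Rs /allR_cons[Rv _]; rewrite act_cat => E.
apply: (@wred_neq (act y s) v); first exact: inR_neq.
have W : inW (wred (act y s) v) by apply: inW_wred; [apply: act_W | apply: inR_W].
have := act_revK (l := rev s) _ W; rewrite revK => <-; last exact/allR_rev.
by congr act.
Qed.

(** The vertex y is arbitrary because stripping a common first entry a moves the base point from y
    to y.a. *)
Lemma act_palindrome_inj y s1 s2 : inW y -> s1 <> [::] -> s2 <> [::] ->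
    allR s1 -> allR s2 -> sorted neq s1 -> sorted neq s2 ->
  act y (palindrome s1) = act y (palindrome s2) -> s1 = s2.
Proof.
move=> + + + + + + + E.
have [n] := ubnP (size s1 + size s2).
elim: n y s1 s2 E => // n IH y [|a s1] [|b s2] // E sn Wy _ _ Ra Rb S1 S2.
have := Ra; have := Rb; rewrite !allR_cons => -[bR R2] [aR R1].
have [ab|nab] := eqVneq a b; last first.
  case: (@act_palindrome_neq y (a :: s1)) => //.
  have Rp1 := allR_palindrome Ra; have Rp2 := allR_palindrome Rb.
  (* Different first entries make this concatenation cyclically reduced; it fixes both y and its
     image under either palindrome. *)
  apply: (@act_fix_unique (palindrome (a :: s1) ++ palindrome (b :: s2))).
  - by [].
  - exact/allR_cat.
  - have := palindrome_sorted S1; have := palindrome_sorted S2.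
    have [p1 -> l1] := palindrome_head a s1; have [p2 -> l2] := palindrome_head b s2.
    by rewrite /= rcons_path cat_path last_cat /= l1 l2 nab (eq_sym b) nab => -> ->.
  - exact: act_W.
  - by [].
  - by rewrite act_cat act_palindromeK // E.
  by rewrite act_cat E act_palindromeK.
subst b; have Wa := inR_W aR; have Wya := inW_wred Wy Wa.
(* One list is a alone: removing the outer a from the other palindrome leaves one that acts on y as
   a does. By induction s is a alone, so a :: s repeats a. *)
have short s : s <> [::] -> allR s -> path neq a s -> size s + 1 < n ->
    wred y a = act y (palindrome (a :: s)) -> False.
  move=> sN Rs ps sz; rewrite act_palindrome_cons // => E'.
  have /(congr1 (fun z => act z (palindrome s))) : act (wred y a) (palindrome s) = y.
    rewrite -[LHS](wredK (v := a)) // -?E' ?wredK //.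
    by apply: act_W => //; apply: allR_palindrome.
  rewrite act_palindromeK // => E2.
  have E3 : [:: a] = s.
    by apply: (IH y) => //=; [lia | apply/allR_cons | case: (s) ps => //= ? ? /andP[]].
  by move: ps; rewrite -E3 /= eqxx.
case: s1 s2 => [|a1 s1] [|b1 s2] in E sn Ra Rb S1 S2 R1 R2 *; first by [].
- by case: (short (b1 :: s2)) => //; move: sn; rewrite /=; lia.
- by case: (short (a1 :: s1)) => //; move: sn; rewrite /=; lia.
congr cons; apply: (IH (wred y a)) => //.
- move: E; rewrite act_palindrome_cons // [RHS]act_palindrome_cons //.
  move=> /(congr1 (fun z : word r => wred z a)); rewrite !wredK //; apply: act_W => //; exact: allR_palindrome.
- by move: sn; rewrite /=; lia.
- by case/andP: S1.
by case/andP: S2.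
Qed.

(** If the new entry equals the head of the reduced tail, both are dropped, as they cancel on either
    side of the palindrome. A tail of one entry is the exception: there vvv acts as v. *)
Lemma reduced_palindrome s : s <> [::] -> allR s ->
  exists s', [/\ s' <> [::], allR s', sorted neq s' &
    forall y, inW y -> act y (palindrome s') = act y (palindrome s)].
Proof.
elim: s => // v s IH _ /allR_cons[Rv Rs].
have Wv := inR_W Rv.
have [->|/eqP sN] := eqVneq s [::].
  by exists [:: v]; split=> //; apply/allR_cons.
have [[|w s'] [s'N Rs' Ss' sE]] := IH sN Rs; first by [].
have actE y : inW y ->
    act y (palindrome (v :: s)) = wred (act (wred y v) (palindrome (w :: s'))) v.
  move=> Wy; rewrite act_palindrome_cons // sE //.
  exact: inW_wred.
have [vw|nvw] := eqVneq v w; last first.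
  exists (v :: w :: s'); split=> //; first exact/allR_cons.
    by rewrite /= nvw.
  by move=> y Wy; rewrite actE // act_palindrome_cons //.
subst w; have [s'E|/eqP s'N'] := eqVneq s' [::].
  by exists [:: v]; split=> // [|y Wy]; [exact/allR_cons | rewrite actE // s'E /= !wredK // inW_wred].
case/allR_cons: Rs' => _ Rs'; exists s'; split=> //.
  by case: (s') Ss' => //= ? ? /andP[].
move=> y Wy; rewrite actE // act_palindrome_cons // !wredK //.
by apply: act_W => //; apply: allR_palindrome.
Qed.

(** * Words of B and the conclusion *)

Lemma inB_spec g : inB g -> inW g /\ allR (factors g).
Proof.
case=> [->|[Wg [s [_ Rs gE]]]] //; split=> //; rewrite gE.
by apply: inR_lnprod_factors => // u /Rs; apply: inR_factors.
Qed.

End Words.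

Theorem theorem4p12 (r : nat) (g : word r) :
  inB g -> g <> wone r ->
  exists! gs : seq (word r),
    [/\ gs <> [::],
        forall u : word r, u \in gs -> inR u,
        g = wpi (lnprod (palindrome gs)) &
        sorted (fun u v : word r => u != v) gs].
Proof.
move=> /inB_spec[Wg Fg] g1.
have [[s v] /= [Rs Rv] gE] := conjugate_B Wg g1 Fg.
(* The conjugate found may have equal neighbouring entries. *)
have [||s' [s'N Rs' Ss' E]] := @reduced_palindrome r (rcons s v).
- by case: s {Rs gE}.
- by rewrite -cats1; apply/allR_cat; split=> //; apply/allR_cons.
have gE' : g = act None (palindrome s') by rewrite E // palindrome_rcons.
exists s'; split=> [|s2 [s2N Rs2 gE2 Ss2]].
  by split=> //; rewrite wpi_lnprod //; exact: allR_palindrome.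
rewrite wpi_lnprod in gE2; last exact: allR_palindrome.
by apply: (@act_palindrome_inj _ None) => //; rewrite -gE'.
Qed.
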